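(* Let $d>0$ be real, let $n\ge 1$ be an integer, and let $W=\operatorname{diag}\left(d^{-(j-1)}\right)_{1\le j\le n}$. Then $$\operatorname{cond}_{2,W}(V_n(d))=\frac{d+1+2\sqrt{d}\cos\left(\frac{\pi}{n+1}\right)}{d+1-2\sqrt{d}\cos\left(\frac{\pi}{n+1}\right)}.$$
   Context: For $d>0$ and $n\ge 1$, $V_n(d)$ denotes the $n\times n$ tridiagonal Toeplitz matrix with all diagonal entries equal to $d+1$, all superdiagonal entries (positions $(i,i+1)$) equal to $1$, all subdiagonal entries (positions $(i+1,i)$) equal to $d$, and all other entries $0$. For a symmetric positive definite matrix $W$, put $\langle x,y\rangle_W=x^{T}Wy$ and $\|x\|_W=\sqrt{\langle x,x\rangle_W}$ for $x,y\in\mathbb{R}^n$; for $M\in\mathbb{R}^{n\times n}$, $\|M\|_{2,W}=\sup_{x\ne 0}\|Mx\|_W/\|x\|_W$, and for invertible $M$ the weighted condition number is $\operatorname{cond}_{2,W}(M)=\|M\|_{2,W}\,\|M^{-1}\|_{2,W}$. *)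

(* Defs.v *)
From HB Require Import structures.
From mathcomp Require Import all_boot all_order all_algebra.
From mathcomp Require Import ring lra.
From mathcomp Require Import all_classical all_reals all_analysis.

Set Implicit Arguments.
Unset Strict Implicit.
Unset Printing Implicit Defensive.

Import Order.TTheory GRing.Theory Num.Theory.
Import numFieldNormedType.Exports.

Local Open Scope classical_set_scope.
Local Open Scope ring_scope.

Definition toeplitzV (R : realType) (n : nat) (d : R) : 'M[R]_n :=
  \matrix_(i < n, j < n)
    if j == i :> nat then d + 1
    else if j == i.+1 :> nat then 1
    else if i == j.+1 :> nat then d
    else 0.

(* Indices start at 0, so entry [j] is the 1-based entry [j.+1]. *)
Definition weightW (R : realType) (n : nat) (d : R) : 'M[R]_n :=
  diag_mx (\row_(j < n) d ^- j).

Definition wdot (R : realType) (n : nat) (W : 'M[R]_n) (x y : 'cV[R]_n) : R :=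
  (x^T *m W *m y) 0 0.

Definition wnorm (R : realType) (n : nat) (W : 'M[R]_n) (x : 'cV[R]_n) : R :=
  Num.sqrt (wdot W x x).

Definition opnorm (R : realType) (n : nat) (W M : 'M[R]_n) : R :=
  sup [set wnorm W (M *m x) / wnorm W x | x in [set x : 'cV[R]_n | x != 0]].

(* Only meaningful for invertible [M] ([invmx M] is [M] otherwise) and for
   symmetric positive definite [W]; the lemmas below check both conditions for
   [toeplitzV n d] and [weightW n d]. *)
Definition wcond (R : realType) (n : nat) (W M : 'M[R]_n) : R :=
  opnorm W M * opnorm W (invmx M).

Lemma weightW_sym (R : realType) (n : nat) (d : R) :
  (weightW n d)^T = weightW n d.
Proof. exact: tr_diag_mx. Qed.

Lemma weightW_posdef (R : realType) (n : nat) (d : R) (x : 'cV[R]_n) :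
  0 < d -> x != 0 -> 0 < wdot (weightW n d) x x.
Proof.
move=> d0 xN0.
have E : wdot (weightW n d) x x = \sum_j x j 0 ^+ 2 * d ^- j.
  rewrite /wdot /weightW mul_mx_diag mxE; apply: eq_bigr => j _.
  by rewrite !mxE mulrAC expr2.
have ge0 (j : 'I_n) : 0 <= x j 0 ^+ 2 * d ^- j.
  by rewrite mulr_ge0 ?sqr_ge0 ?invr_ge0 ?exprn_ge0 ?ltW.
rewrite E lt_neqAle sumr_ge0 1?andbT => [|j _]; last exact: ge0.
apply: contra xN0; rewrite eq_sym psumr_eq0 => [/allP x0|j _]; last exact: ge0.
apply/eqP/colP => j; rewrite mxE.
have := x0 j (mem_index_enum j); rewrite /= mulf_eq0 invr_eq0 !expf_eq0.
by rewrite (gt_eqF d0) !andbF orbF => /eqP.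
Qed.

Lemma toeplitzV_unit (R : realType) (n : nat) (d : R) :
  0 < d -> toeplitzV n d \in unitmx.
Proof.
move=> d0; rewrite -row_free_unit -kermx_eq0; apply/rowV0P => x /sub_kermxP xV.
pose f k := \sum_(i < n) x 0 i * (i == k :> nat)%:R.
have fE (i : 'I_n) : f i = x 0 i.
  rewrite /f (bigD1 i) //= eqxx mulr1 big1 ?addr0 // => j ji.
  by rewrite (negbTE (ji : (j != i :> nat))) mulr0.
have fn : f n = 0.
  by rewrite /f big1 // => i _; rewrite (ltn_eqF (ltn_ord i)) mulr0.
have rec k : (k < n)%N ->
    (if k is k'.+1 then f k' else 0) + (d + 1) * f k + d * f k.+1 = 0.
  move=> kn; have /rowP/(_ (Ordinal kn)) := xV; rewrite !mxE => H; apply: etrans H.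
  have -> : (if k is k'.+1 then f k' else 0)
          = \sum_(i < n) x 0 i * (k == i.+1)%:R.
    case: k {kn} => [|k]; first by rewrite big1 // => i _; rewrite mulr0.
    by apply: eq_bigr => i _; rewrite eqSS eq_sym.
  rewrite /f !mulr_sumr -!big_split /=; apply: eq_bigr => i _; rewrite mxE /=.
  rewrite [k == i :> nat]eq_sym.
  have [->|ik] := eqVneq (i : nat) k.
    rewrite ?eqxx (ltn_eqF (ltnSn k)) /=. ring.
  have [->|ki] := eqVneq k i.+1.
    rewrite ?eqxx ?(ltn_eqF (leqW (ltnSn i))) /=. ring.
  by case: eqP => _ /=; ring.
pose s k := \sum_(i < k.+1) d ^+ i.
have sS k : s k.+1 = s k + d ^+ k.+1 by rewrite /s big_ord_recr.
have cl k : (k < n)%N -> d ^+ k * f k = (-1) ^+ k * s k * f 0%N /\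
    d ^+ k.+1 * f k.+1 = (-1) ^+ k.+1 * s k.+1 * f 0%N.
  elim: k => [|k IH] kn.
    have := rec 0%N kn; rewrite sS /s big_ord1 /= !expr0 !expr1 => H.
    by split; [ring | lra].
  have [H1 H2] := IH (ltnW kn); split => //.
  have H := rec k.+1 kn.
  have -> : d ^+ k.+2 * f k.+2
      = - (d * (d ^+ k * f k)) - (d + 1) * (d ^+ k.+1 * f k.+1).
    have -> : d ^+ k.+2 * f k.+2 = d ^+ k.+1 * (d * f k.+2).
      by rewrite (exprS d k.+1); ring.
    have -> : d * f k.+2 = - (f k + (d + 1) * f k.+1) by lra.
    by rewrite (exprS d k); ring.
  by rewrite H1 H2 !sS !exprS; ring.
apply/rowP => i; rewrite mxE -fE.
have n0 : (0 < n)%N by case: (i) => m; apply: leq_ltn_trans.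
have f0 : f 0%N = 0.
  have kn : (n.-1 < n)%N by rewrite prednK.
  have [_] := cl _ kn; rewrite prednK // fn mulr0 => /esym/eqP.
  have sn : 0 < s n.
    rewrite /s big_ord_recl expr0 ltr_pwDl // sumr_ge0 // => j _.
    by rewrite exprn_ge0 // ltW.
  by rewrite !mulf_eq0 signr_eq0 (gt_eqF sn) => /eqP.
have [] := cl i (ltn_ord i); rewrite f0 mulr0 => /eqP + _.
by rewrite mulf_eq0 expf_eq0 (gt_eqF d0) andbF => /eqP.
Qed.

(* Main.v *)
Require Import Defs.
From HB Require Import structures.
From mathcomp Require Import all_boot all_order all_algebra.
From mathcomp Require Import ring lra.
From mathcomp Require Import all_classical all_reals all_analysis.

Import Order.TTheory GRing.Theory Num.Theory.
Import numFieldNormedType.Exports.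

Local Open Scope ring_scope.

(** Write the Toeplitz matrix as [(d + 1)%:M + B], where [B] has zero diagonal.
    It suffices to find a [c < d + 1] such that [B] has [W]-norm at most [c] and
    has both [c] and [- c] as eigenvalues.  By the two triangle inequalities,
    [(d + 1 - c) |x| <= |V x| <= (d + 1 + c) |x|], and the two eigenvectors
    show that neither bound can be improved; the lower bound controls the
    inverse of [V], so the condition number is [(d + 1 + c) / (d + 1 - c)]
    ([wcond_shift]).

    The eigenvectors are explicit: if [q ^+ 2 = d], the addition formulas for
    the sine show that the vector with 1-based entries
    [q ^+ j * sin (j * pi / (n + 1))] is an eigenvector of [B] for
    [2 * q * cos (pi / (n + 1))] ([offdiagV_sine_vec]).  The two square roots
    of [d] give the eigenvalues [c] and [- c].

    The norm bound comes from the positive root: [B] has nonnegative entries, is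
    self-adjoint for [W], and its eigenvector for [c] has positive entries, so
    the Schur test ([schur_test]) bounds its [W]-norm by [c].  This avoids
    diagonalizing [V]: only its two extreme eigenvectors are needed. *)

(** * Norms of semidefinite forms *)

Section SemiInnerProduct.
Context {R : realType} {n : nat} {W : 'M[R]_n}.
Hypothesis W_sym : W^T = W.
Hypothesis W_psd : forall x : 'cV[R]_n, 0 <= wdot W x x.

Lemma wdotC (x y : 'cV[R]_n) : wdot W x y = wdot W y x.
Proof.
rewrite /wdot -[in LHS](trmxK (x^T *m W *m y)) mxE.
by rewrite !trmx_mul trmxK W_sym mulmxA.
Qed.

Lemma wdotDl (x y z : 'cV[R]_n) : wdot W (x + y) z = wdot W x z + wdot W y z.
Proof. by rewrite /wdot linearD /= !mulmxDl mxE. Qed.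

Lemma wdotZl (a : R) (x y : 'cV[R]_n) : wdot W (a *: x) y = a * wdot W x y.
Proof. by rewrite /wdot linearZ /= -!scalemxAl mxE. Qed.

Lemma wdotDr (x y z : 'cV[R]_n) : wdot W x (y + z) = wdot W x y + wdot W x z.
Proof. by rewrite wdotC wdotDl !(wdotC x). Qed.

Lemma wdotZr (a : R) (x y : 'cV[R]_n) : wdot W x (a *: y) = a * wdot W x y.
Proof. by rewrite wdotC wdotZl wdotC. Qed.

Lemma wdot_sqr_comb (a b : R) (x y : 'cV[R]_n) :
  wdot W (a *: x + b *: y) (a *: x + b *: y) =
  a ^+ 2 * wdot W x x + 2 * a * b * wdot W x y + b ^+ 2 * wdot W y y.
Proof. by rewrite !(wdotDl, wdotDr, wdotZl, wdotZr) (wdotC y x); ring. Qed.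

(** Stated for semidefinite forms because [schur_test] uses it with weights
    taken from a row of a matrix that may contain zeros. *)
Lemma wdot_cauchy_schwarz (x y : 'cV[R]_n) :
  wdot W x y ^+ 2 <= wdot W x x * wdot W y y.
Proof.
set X := wdot W x x; set Y := wdot W y y; set P := wdot W x y.
have comb_ge0 a b : 0 <= a ^+ 2 * X + 2 * a * b * P + b ^+ 2 * Y.
  by rewrite -wdot_sqr_comb.
have X0 : 0 <= X := W_psd x.
have Y0 : 0 <= Y := W_psd y.
(* The vectors X y - P x and Y x - P y have squared norms X (X Y - P^2) and
   Y (X Y - P^2); using both leaves X = Y = 0 as the only degenerate case. *)
have XYP : 0 <= (X + Y) * (X * Y - P ^+ 2).
  have := addr_ge0 (comb_ge0 (- P) X) (comb_ge0 Y (- P)).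
  by congr (0 <= _); ring.
have [XY0|XY0] := eqVneq (X + Y) 0.
  have -> : P = 0.
    by have := comb_ge0 1 1; have := comb_ge0 1 (- 1); rewrite !expr2; lra.
  by rewrite expr0n mulr_ge0.
by rewrite -subr_ge0 -(pmulr_rge0 _ (_ : 0 < X + Y)) // lt_def XY0 addr_ge0.
Qed.

Lemma wnorm_ge0 (x : 'cV[R]_n) : 0 <= wnorm W x.
Proof. exact: sqrtr_ge0. Qed.

Lemma wnorm_sqr (x : 'cV[R]_n) : wnorm W x ^+ 2 = wdot W x x.
Proof. by rewrite sqr_sqrtr. Qed.

Lemma wnormZ (a : R) (x : 'cV[R]_n) : wnorm W (a *: x) = `|a| * wnorm W x.
Proof.
by rewrite /wnorm wdotZl wdotZr mulrA -expr2 sqrtrM ?sqr_ge0 // sqrtr_sqr.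
Qed.

Lemma wnormD (x y : 'cV[R]_n) : wnorm W (x + y) <= wnorm W x + wnorm W y.
Proof.
rewrite -(@ler_pXn2r _ 2) ?nnegrE ?addr_ge0 ?wnorm_ge0 //.
have : wdot W x y <= wnorm W x * wnorm W y.
  apply: le_trans (ler_norm _) _.
  rewrite -(@ler_pXn2r _ 2) ?nnegrE ?mulr_ge0 ?wnorm_ge0 ?normr_ge0 //.
  by rewrite real_normK ?num_real // exprMn !wnorm_sqr wdot_cauchy_schwarz.
have := wdot_sqr_comb 1 1 x y; rewrite !scale1r wnorm_sqr => ->.
by rewrite -!wnorm_sqr !expr2; lra.
Qed.

Lemma wnorm_subl (x y : 'cV[R]_n) : wnorm W x - wnorm W y <= wnorm W (x + y).
Proof.
rewrite lerBlDr -{1}(addrK y x); apply: le_trans (wnormD _ _) _.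
by rewrite -scaleN1r wnormZ normrN1 mul1r.
Qed.

End SemiInnerProduct.

(** * Operator norm and condition number *)

Section OperatorNorm.
Context {R : realType} {n : nat} {W : 'M[R]_n}.
Hypothesis W_sym : W^T = W.
Hypothesis W_pos : forall x : 'cV[R]_n, x != 0 -> 0 < wdot W x x.

Lemma posdef_psd (x : 'cV[R]_n) : 0 <= wdot W x x.
Proof.
have [->|/W_pos/ltW//] := eqVneq x 0.
by rewrite /wdot mulmx0 mxE.
Qed.

Lemma wnorm_gt0 (x : 'cV[R]_n) : x != 0 -> 0 < wnorm W x.
Proof. by move=> /W_pos; rewrite sqrtr_gt0. Qed.

Lemma opnorm_attained (M : 'M[R]_n) (r : R) (v : 'cV[R]_n) :
  (forall x, wnorm W (M *m x) <= r * wnorm W x) ->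
  v != 0 -> wnorm W (M *m v) = r * wnorm W v -> opnorm W M = r.
Proof.
move=> Mr v0 Mv; rewrite /opnorm; set E := (X in sup X).
have ubE : ubound E r.
  by move=> _ [x x0 <-]; rewrite ler_pdivrMr ?wnorm_gt0.
have Er : E r by exists v => //; rewrite Mv mulfK // gt_eqF ?wnorm_gt0.
apply/le_anti/andP; split; first by apply: ge_sup => //; exists r.
by apply: ub_le_sup => //; exists r.
Qed.

(** The norms of [a%:M + B] and of its inverse are attained at [u] and [v]
    respectively. *)
Lemma wcond_shift (a c : R) (B : 'M[R]_n) (u v : 'cV[R]_n) :
  c < a -> (forall x, wnorm W (B *m x) <= c * wnorm W x) ->
  u != 0 -> B *m u = c *: u -> v != 0 -> B *m v = - c *: v ->
  a%:M + B \in unitmx -> wcond W (a%:M + B) = (a + c) / (a - c).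
Proof.
move=> ca Bc u0 Bu v0 Bv; set M := a%:M + B => Munit.
have psd := posdef_psd.
have c0 : 0 <= c.
  by rewrite -(pmulr_lge0 _ (wnorm_gt0 _ u0)) (le_trans _ (Bc u)) ?wnorm_ge0.
have ac : 0 < a - c by rewrite subr_gt0.
have a0 : 0 <= a by rewrite (le_trans c0) ?ltW.
have Mx (x : 'cV[R]_n) : M *m x = a *: x + B *m x.
  by rewrite mulmxDl mul_scalar_mx.
have wnormaZ (x : 'cV[R]_n) : wnorm W (a *: x) = a * wnorm W x.
  by rewrite wnormZ // ger0_norm.
have Mle x : wnorm W (M *m x) <= (a + c) * wnorm W x.
  rewrite Mx; apply: le_trans (wnormD W_sym psd _ _) _.
  by rewrite wnormaZ mulrDl lerD2l.
have Mge x : (a - c) * wnorm W x <= wnorm W (M *m x).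
  rewrite Mx; apply: le_trans (wnorm_subl W_sym psd _ _).
  by rewrite wnormaZ mulrBl lerD2l lerN2.
have Mu : M *m u = (a + c) *: u by rewrite Mx Bu -scalerDl.
have Mv : M *m v = (a - c) *: v by rewrite Mx Bv -scalerDl.
rewrite /wcond (@opnorm_attained M (a + c) u) //; last first.
  by rewrite Mu wnormZ // ger0_norm // addr_ge0.
congr (_ * _); apply: (@opnorm_attained _ _ v) => // [x|].
  rewrite mulrC ler_pdivlMr // mulrC; apply: le_trans (Mge _) _.
  by rewrite mulKVmx.
have -> : invmx M *m v = (a - c)^-1 *: v.
  by rewrite -{1}[v](scalerK (lt0r_neq0 ac)) -Mv -scalemxAr mulKmx.
by rewrite wnormZ // ger0_norm // invr_ge0 ltW.
Qed.

End OperatorNorm.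

(** * The Schur test *)

Lemma wdot_diag {R : realType} {n : nat} (w : 'rV[R]_n) (x y : 'cV[R]_n) :
  wdot (diag_mx w) x y = \sum_j w 0 j * (x j 0 * y j 0).
Proof.
rewrite /wdot mul_mx_diag mxE; apply: eq_bigr => j _.
by rewrite !mxE mulrCA mulrA.
Qed.

Lemma wdot_diag_psd {R : realType} {n : nat} (w : 'rV[R]_n) (x : 'cV[R]_n) :
  (forall j, 0 <= w 0 j) -> 0 <= wdot (diag_mx w) x x.
Proof.
move=> w0; rewrite wdot_diag sumr_ge0 // => j _.
by rewrite mulr_ge0 // -expr2 sqr_ge0.
Qed.

(** Cauchy-Schwarz with weights [B i j / u j], applied to [u] and [x] in each
    row, gives [(B x)_i ^ 2 <= c u_i * \sum_j B i j * x_j ^ 2 / u_j].  Summing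
    over [i] with weights [w i], the symmetry of [w i * B i j] turns the
    coefficient of [x_j ^ 2 / u_j] into [c w_j (B u)_j = c ^ 2 w_j u_j]. *)
Lemma schur_test {R : realType} {n : nat} (w : 'rV[R]_n) (B : 'M[R]_n)
    (u : 'cV[R]_n) (c : R) :
  (forall j, 0 <= w 0 j) -> (forall i j, 0 <= B i j) ->
  (forall i j, w 0 i * B i j = w 0 j * B j i) ->
  (forall j, 0 < u j 0) -> 0 <= c -> B *m u = c *: u ->
  forall x, wnorm (diag_mx w) (B *m x) <= c * wnorm (diag_mx w) x.
Proof.
move=> w0 B0 wB u0 c0 Bu x.
have Bui i : \sum_j B i j * u j 0 = c * u i 0.
  by have /colP/(_ i) := Bu; rewrite !mxE.
have psd y := wdot_diag_psd _ y w0.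
rewrite -(@ler_pXn2r _ 2) ?nnegrE ?mulr_ge0 ?wnorm_ge0 // exprMn !wnorm_sqr //.
rewrite !wdot_diag.
have row_cs i :
    (B *m x) i 0 ^+ 2 <= c * u i 0 * \sum_j B i j * (x j 0 ^+ 2 / u j 0).
  pose b := \row_j (B i j / u j 0).
  have b0 j : 0 <= b 0 j by rewrite mxE divr_ge0 // ltW.
  have := wdot_cauchy_schwarz (tr_diag_mx b) (fun y => wdot_diag_psd _ y b0) u x.
  rewrite !wdot_diag -Bui mxE.
  congr (_ ^+ 2 <= _ * _); apply: eq_bigr => j _; rewrite mxE;
    by field; rewrite lt0r_neq0.
apply: (@le_trans _ _
    (\sum_i w 0 i * (c * u i 0 * \sum_j B i j * (x j 0 ^+ 2 / u j 0)))).
  by apply: ler_sum => i _; rewrite ler_wpM2l // -expr2.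
under eq_bigr do rewrite mulrA mulr_sumr.
rewrite exchange_big /= mulr_sumr le_eqVlt; apply/orP; left; apply/eqP.
apply: eq_bigr => j _.
transitivity (c * w 0 j * (x j 0 ^+ 2 / u j 0) * \sum_i B j i * u i 0).
  rewrite mulr_sumr; apply: eq_bigr => i _.
  transitivity (c * u i 0 * (x j 0 ^+ 2 / u j 0) * (w 0 i * B i j)).
    by ring.
  by rewrite wB; ring.
by rewrite Bui; field; rewrite lt0r_neq0.
Qed.

(** * Extreme eigenvectors of the Toeplitz matrix *)

Definition offdiagV {R : realType} (n : nat) (d : R) : 'M[R]_n :=
  \matrix_(i < n, j < n)
    ((j == i.+1 :> nat)%:R + d * (i == j.+1 :> nat)%:R).

Lemma toeplitzV_shift (R : realType) (n : nat) (d : R) :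
  toeplitzV n d = (d + 1)%:M + offdiagV n d.
Proof.
apply/matrixP => i j; rewrite !mxE -val_eqE /=.
have [->|ij] := eqVneq (j : nat) i.
  by rewrite ltn_eqF // mulr0 !addr0 mulr1n.
rewrite mulr0n add0r.
have [->|ji] := eqVneq (j : nat) i.+1; last by case: eqP => _ /=; ring.
by rewrite (ltn_eqF (leqW (ltnSn i))) /=; ring.
Qed.

(** The weights make [offdiagV] self-adjoint: [d ^- i = d ^- i.+1 * d]. *)
Lemma weightV_balance (R : realType) (n : nat) (d : R) (i j : 'I_n) :
  d != 0 ->
  (\row_(k < n) d ^- k) 0 i * offdiagV n d i j =
  (\row_(k < n) d ^- k) 0 j * offdiagV n d j i.
Proof.
move=> d0; rewrite !mxE.
have [->|ij] := eqVneq (j : nat) i.+1.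
  by rewrite (ltn_eqF (leqW (ltnSn i))) exprS /=; field; rewrite expf_neq0 ?d0.
have [->|ji] := eqVneq (i : nat) j.+1; last by rewrite /=; ring.
by rewrite exprS /=; field; rewrite expf_neq0 ?d0.
Qed.

Lemma sum_ord_pick {R : realType} (n k : nat) (h : nat -> R) :
  \sum_(j < n) (j == k :> nat)%:R * h j = if (k < n)%N then h k else 0.
Proof.
under eq_bigr do rewrite mulr_natl mulrb.
rewrite -big_mkcond /=.
case: ifPn => [kn|]; first by rewrite (big_pred1 (Ordinal kn)).
rewrite -leqNgt => nk; rewrite big_pred0 // => j.
by rewrite ltn_eqF // (leq_trans _ nk).
Qed.

(** Padding the vector with a zero at both ends ([g 0] and [g n.+1]) makes the
    first and last rows follow the same recurrence as the others. *)
Lemma offdiagV_mul (R : realType) (n : nat) (d : R) (g : nat -> R) :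
  g 0%N = 0 -> g n.+1 = 0 ->
  offdiagV n d *m \col_j g j.+1 = \col_i (g i.+2 + d * g i).
Proof.
move=> g0 gn; apply/colP => i; rewrite !mxE.
under eq_bigr do rewrite !mxE mulrDl -mulrA.
rewrite big_split /= -mulr_sumr; congr (_ + d * _).
  rewrite (sum_ord_pick _ _ (fun j => g j.+1)); case: ltnP => // ni.
  by rewrite -gn; congr (g _); apply/eqP; rewrite eqSS eqn_leq ni ltn_ord.
case: i => [[|i] /= lin].
  by rewrite big1 ?g0 // => j _; rewrite mul0r.
under eq_bigr do rewrite eqSS eq_sym.
by rewrite (sum_ord_pick _ _ (fun j => g j.+1)) ltnW.
Qed.

(** The [q]-scaled first discrete sine vector; a negative [q] gives alternating
    signs. *)
Definition sine_vec {R : realType} (n : nat) (q : R) : 'cV[R]_n :=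
  \col_j (q ^+ j.+1 * sin (j.+1%:R * (pi / n.+1%:R))).

(** Uses [sin ((j + 1) t) + sin ((j - 1) t) = 2 * sin (j t) * cos t]. The sine
    vanishes at the padding indices [0] and [n + 1] because
    [(n + 1) t = pi]. *)
Lemma offdiagV_sine_vec {R : realType} (n : nat) (q : R) :
  offdiagV n (q ^+ 2) *m sine_vec n q =
  (2 * q * cos (pi / n.+1%:R)) *: sine_vec n q.
Proof.
set t := pi / n.+1%:R.
rewrite (offdiagV_mul _ _ (q ^+ 2) (fun j => q ^+ j * sin (j%:R * t))).
- apply/colP => i; rewrite !mxE.
  have -> : i.+2%:R * t = i.+1%:R * t + t by rewrite -natr1; ring.
  have -> : i%:R * t = i.+1%:R * t - t by rewrite -natr1; ring.
  by rewrite sinD sinB !exprS; ring.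
- by rewrite mul0r sin0 mulr0.
- by rewrite /t [_%:R * _]mulrC divfK ?pnatr_eq0 // sinpi mulr0.
Qed.

Lemma sin_node_gt0 (R : realType) (n j : nat) :
  (j < n)%N -> 0 < sin (j.+1%:R * (pi / n.+1%:R)) :> R.
Proof.
move=> jn; rewrite sin_gt0_pi // mulr_gt0 ?divr_gt0 ?pi_gt0 ?ltr0n //=.
by rewrite mulrCA gtr_pMr ?pi_gt0 // ltr_pdivrMr ?ltr0n // mul1r ltr_nat.
Qed.

Lemma cos_node_ge0 (R : realType) (n : nat) :
  (0 < n)%N -> 0 <= cos (pi / n.+1%:R) :> R.
Proof.
move=> n0; apply: cos_ge0_pihalf; apply/andP; split.
  by rewrite (@le_trans _ _ 0) ?oppr_le0 ?divr_ge0 ?pi_ge0 ?ler0n.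
by rewrite ler_wpM2l ?pi_ge0 // lef_pV2 ?posrE ?ltr0n // ler_nat.
Qed.

Lemma cos_node_lt1 (R : realType) (n : nat) :
  (0 < n)%N -> cos (pi / n.+1%:R) < 1 :> R.
Proof.
move=> n0; set t := pi / n.+1%:R.
have sin_t : 0 < sin t by have := @sin_node_gt0 R n 0 n0; rewrite mul1r.
have := cos2Dsin2 t; have := cos_le1 t; rewrite le_eqVlt => /orP[/eqP ->|//].
by rewrite expr1n; have := exprn_gt0 2 sin_t; lra.
Qed.

Lemma sine_vec_neq0 (R : realType) (n : nat) (q : R) :
  (0 < n)%N -> q != 0 -> sine_vec n q != 0.
Proof.
move=> n0 q0; apply/eqP => /colP/(_ (Ordinal n0)); rewrite !mxE => /eqP.
by rewrite mulf_eq0 expf_eq0 (negbTE q0) gt_eqF ?sin_node_gt0.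
Qed.

Theorem corollary6p5 (R : realType) (n : nat) (d : R)
    (hd : 0 < d) (hn : (1 <= n)%N) :
  wcond (weightW n d) (toeplitzV n d) =
  (d + 1 + 2 * Num.sqrt d * cos (pi / n.+1%:R)) /
  (d + 1 - 2 * Num.sqrt d * cos (pi / n.+1%:R)).
Proof.
set s := Num.sqrt d; set t := pi / n.+1%:R.
have s0 : 0 < s by rewrite sqrtr_gt0.
have sd : s ^+ 2 = d by rewrite sqr_sqrtr // ltW.
have cos_ge0 : 0 <= cos t by apply: cos_node_ge0.
have cos_lt1 : cos t < 1 by apply: cos_node_lt1.
have ca : 2 * s * cos t < d + 1.
  (* By AM-GM, 2 s <= d + 1. *)
  have : 0 < s * (1 - cos t) by rewrite mulr_gt0 // subr_gt0.
  have := sqr_ge0 (s - 1); rewrite -sd !expr2; lra.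
have eig q : q ^+ 2 = d ->
    offdiagV n d *m sine_vec n q = (2 * q * cos t) *: sine_vec n q.
  by move=> <-; apply: offdiagV_sine_vec.
rewrite toeplitzV_shift.
apply: (@wcond_shift _ _ _ _ _ _ _ _ (sine_vec n s) (sine_vec n (- s))) => //.
- exact: weightW_sym.
- by move=> x; apply: weightW_posdef.
- apply: (@schur_test _ _ _ _ (sine_vec n s)).
  + by move=> j; rewrite mxE invr_ge0 exprn_ge0 ?ltW.
  + by move=> i j; rewrite mxE addr_ge0 ?mulr_ge0 ?ler0n ?ltW.
  + by move=> i j; apply: weightV_balance; rewrite lt0r_neq0.
  + by move=> j; rewrite mxE mulr_gt0 ?exprn_gt0 ?sin_node_gt0.
  + by rewrite mulr_ge0 // mulr_ge0 // ltW.
  + exact: eig.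
- by rewrite sine_vec_neq0 ?lt0r_neq0.
- exact: eig.
- by rewrite sine_vec_neq0 ?oppr_eq0 ?lt0r_neq0.
- by rewrite eig ?sqrrN // mulrN mulNr.
- by rewrite -toeplitzV_shift toeplitzV_unit.
Qed.
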